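(* Let $\alpha\neq0$, $\kappa\ne0$, $\mathcal A\neq 0$ and $c$ be real numbers with $\mathcal A\kappa>-\frac{3c^2}{8}$. Choose the sign $\pm$ (the same in all places below) so that $\pm\alpha>0$. Then $$u(x,t)=\frac{3c\pm\sqrt{9c^2+24\mathcal A\kappa}}{2\kappa}\;\mathrm{cn}^2\left[\frac12\,\frac{\sqrt[4]{9c^2+24\mathcal A\kappa}}{\sqrt{\pm3\alpha}}\,(x-ct);\ \sqrt{\frac12\pm\frac{3c}{2\sqrt{9c^2+24\mathcal A\kappa}}}\,\right]$$ is a solution on $\mathbb R^2$ of the Korteweg–de Vries equation $$u_t+\kappa uu_x+\alpha u_{xxx}=0,$$ and as a function of $\xi=x-ct$ it satisfies the integrated traveling wave equation $-cu+\frac{\kappa}{2}u^2+\alpha u_{\xi\xi}=\mathcal A$.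
   Context: $\mathrm{cn}(\theta;m)$ denotes the Jacobi elliptic cosine with modulus $m$ (not parameter $m^2$). It depends on $m$ only through $m^2$, and for any real value of $m^2$ (including values outside $[0,1]$) it is understood as the solution $w$ of $w''=(2m^2-1)w-2m^2w^3$, $w(0)=1$, $w'(0)=0$, which satisfies $(w')^2=(1-w^2)(1-m^2+m^2w^2)$. ''Nonzero boundary conditions'' means that the integration constant $\mathcal A$ in the integrated traveling wave equation is nonzero. *)

(* Defs.v *)
From Stdlib Require Import Reals ClassicalEpsilon.
From Coquelicot Require Import Coquelicot.
Open Scope R_scope.

(* [w] is the elliptic cosine with squared modulus [mu].  The modulus itself is
   imaginary when [mu < 0], so [mu] (any real number) is the argument. *)
Definition is_jacobi_cn (mu : R) (w : R -> R) : Prop :=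
  w 0 = 1 /\ Derive w 0 = 0 /\
  forall theta : R,
    ex_derive w theta /\
    is_derive (Derive w) theta ((2 * mu - 1) * w theta - 2 * mu * w theta ^ 3).

(* The right-hand side of the equation is locally Lipschitz, so there is at most
   one such function, and the first integral
   w'^2 = (1 - w^2) (1 - mu + mu w^2) keeps the solution with w(0) = 1 bounded,
   so it exists on all of R for every real [mu]. *)
Definition jacobi_cn (mu : R) : R -> R :=
  epsilon (inhabits (fun _ : R => 0)) (is_jacobi_cn mu).

(* [ex_derive_n f 3 x] alone only says that the total function [Derive_n f 2] is
   differentiable at [x]; hence the quantification over the order [k]. *)
Definition kdv_solution (kappa alpha : R) (u : R -> R -> R) : Prop :=
  forall x t : R,
    ex_derive (fun s => u x s) t /\
    (forall k : nat, (k <= 3)%nat -> ex_derive_n (fun y => u y t) k x) /\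
    Derive (fun s => u x s) t
      + kappa * u x t * Derive (fun y => u y t) x
      + alpha * Derive_n (fun y => u y t) 3 x = 0.

Definition integrated_wave_solution (c kappa alpha A : R) (U : R -> R) : Prop :=
  forall xi : R,
    (forall k : nat, (k <= 2)%nat -> ex_derive_n U k xi) /\
    - c * U xi + kappa / 2 * U xi ^ 2 + alpha * Derive_n U 2 xi = A.

Definition discr (c kappa A : R) : R := 9 * c ^ 2 + 24 * A * kappa.

(* [s] is the sign chosen for every occurrence of +/-. *)
Definition cnoidal_profile (s alpha kappa A c : R) (xi : R) : R :=
  (3 * c + s * sqrt (discr c kappa A)) / (2 * kappa)
  * jacobi_cn (1 / 2 + s * (3 * c / (2 * sqrt (discr c kappa A))))
      (1 / 2 * (Rpower (discr c kappa A) (1 / 4) / sqrt (s * (3 * alpha))) * xi)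
    ^ 2.

(* Main.v *)
Require Import Defs.
From Stdlib Require Import Reals Lra Lia Ranalysis5 ClassicalChoice ClassicalEpsilon.
From Coquelicot Require Import Coquelicot.
Open Scope R_scope.

(** A global solution [w] of the Jacobi equation comes from quadrature.  For
    [k < 1] the amplitude [phi' = sqrt (1 - k sin^2 phi)] is the inverse of the
    elliptic integral, whose integrand is positive and bounded away from [0];
    then [cn = cos phi] when the squared modulus is [k = mu < 1].  For [mu > 1]
    the reciprocal modulus transformation gives [cn (x; mu) = dn (sqrt mu x; 1 / mu)],
    and for [mu = 1] the solution is the hyperbolic secant.  The first integral
    turns the equation for [w] into one that is quadratic in [w^2], and comparing
    coefficients yields the integrated wave equation; one more derivative gives KdV. *)

(** * Global solutions of scalar autonomous equations *)

Lemma is_derive_increasing_bound (F f : R -> R) (m : R) :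
  (forall x, is_derive F x (f x)) -> (forall x, m <= f x) ->
  forall x y, x <= y -> m * (y - x) <= F y - F x.
Proof.
  intros HF Hm x y Hxy.
  destruct (MVT_gen F x y f) as [z [_ Hz]].
  - intros; apply HF.
  - intros; apply continuity_pt_filterlim, (ex_derive_continuous F).
    eexists; apply HF.
  - rewrite Hz. apply Rmult_le_compat_r; [lra | apply Hm].
Qed.

(** Separation of variables: [y] is the inverse of the primitive [F] of [/ g]. Since [g <= M], [F]
    has slope at least [/ M], so it maps onto all of R and its inverse is [M]-Lipschitz; hence the
    solution never blows up. *)
Lemma autonomous_ode_global (g : R -> R) (M : R) :
  0 < M -> (forall x, 0 < g x <= M) -> (forall x, continuous g x) ->
  exists y : R -> R, y 0 = 0 /\ forall x, is_derive y x (g (y x)).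
Proof.
  intros HM Hg Cg.
  set (f := fun x => / g x).
  assert (Cf : forall x, continuous f x).
  { intro x. apply continuous_Rinv_comp; [apply Cg | destruct (Hg x); lra]. }
  set (F := fun x => RInt f 0 x).
  assert (HF : forall x, is_derive F x (f x)).
  { intro x. apply (is_derive_RInt f F 0 x); [| apply Cf].
    apply filter_forall; intro z. apply (RInt_correct f 0 z), (ex_RInt_continuous f).
    intros; apply Cf. }
  assert (CF : continuity F).
  { intro x. apply continuity_pt_filterlim, (ex_derive_continuous F).
    eexists; apply HF. }
  assert (F0 : F 0 = 0) by apply (RInt_point 0 f).
  assert (Hm : forall x, / M <= f x).
  { intro x. destruct (Hg x). apply Rinv_le_contravar; lra. }
  assert (HM' : 0 < / M) by (apply Rinv_0_lt_compat; lra).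
  pose proof (is_derive_increasing_bound F f (/ M) HF Hm) as Hinc.
  assert (Hlip : forall x y, x <= y -> y - x <= M * (F y - F x)).
  { intros x y Hxy. specialize (Hinc x y Hxy).
    replace (y - x) with (M * (/ M * (y - x))) by (field; lra).
    apply Rmult_le_compat_l; lra. }
  assert (Hsurj : forall v, exists x, F x = v).
  (* The slope bound forces [F] past [Rabs v] at [b] and below [- Rabs v] at [- b], so the
     intermediate value theorem applies on this interval. *)
  { intro v. set (b := M * Rabs v).
    assert (Hb : 0 <= b) by (apply Rmult_le_pos; [lra | apply Rabs_pos]).
    assert (H1 : Rabs v <= F b).
    { specialize (Hinc 0 b Hb). rewrite F0 in Hinc. unfold b in Hinc at 1.
      replace (/ M * (M * Rabs v - 0)) with (Rabs v) in Hinc by (field; lra). lra. }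
    assert (H2 : F (- b) <= - Rabs v).
    { specialize (Hinc (- b) 0 ltac:(lra)). rewrite F0 in Hinc. unfold b in Hinc at 1.
      replace (/ M * (0 - - (M * Rabs v))) with (Rabs v) in Hinc by (field; lra). lra. }
    destruct (IVT_gen F (- b) b v CF) as [x [_ Hx]]; [| now exists x].
    pose proof (Rle_abs v). pose proof (Rle_abs (- v)). rewrite Rabs_Ropp in H0.
    rewrite Rmin_left, Rmax_right; lra. }
  destruct (choice (fun v x => F x = v) Hsurj) as [G HG].
  assert (Gmono : forall u v, u <= v -> G u <= G v).
  { intros u v Huv. destruct (Rle_dec (G u) (G v)) as [|Hn]; [assumption | exfalso].
    assert (H := Hinc (G v) (G u) ltac:(lra)). rewrite !HG in H.
    assert (0 < / M * (G u - G v)) by (apply Rmult_lt_0_compat; lra). lra. }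
  assert (Glip : forall u v, Rabs (G u - G v) <= M * Rabs (u - v)).
  { intros u v. destruct (Rle_dec u v) as [H|H].
    - rewrite !Rabs_left1 by (try specialize (Gmono u v H); lra).
      specialize (Hlip _ _ (Gmono u v H)). rewrite !HG in Hlip. lra.
    - assert (H' : v <= u) by lra.
      rewrite !Rabs_right by (try specialize (Gmono v u H'); lra).
      specialize (Hlip _ _ (Gmono v u H')). rewrite !HG in Hlip. lra. }
  assert (CG : continuity G).
  { intros x e He. exists (e / M). split; [apply Rdiv_lt_0_compat; lra |].
    intros y [_ Hy]. simpl in *. unfold Rdist in *.
    apply Rle_lt_trans with (1 := Glip y x).
    apply Rlt_le_trans with (M * (e / M)); [apply Rmult_lt_compat_l; lra |].
    right; field; lra. }
  exists G. split.
  (* [F] takes the same value at [G (F 0)] and at 0, so [Hlip] bounds their distance by 0. *)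
  - assert (H := Glip 0 (F 0)). assert (HG0 : G (F 0) = 0).
    { destruct (Rle_dec (G (F 0)) 0) as [H0|H0].
      - specialize (Hlip _ _ H0). rewrite HG in Hlip. lra.
      - specialize (Hlip 0 (G (F 0)) ltac:(lra)). rewrite HG in Hlip. lra. }
    now rewrite F0 in HG0.
  - intro x.
    assert (DF : forall a, derivable_pt_lim F a (f a))
      by (intro a; apply is_derive_Reals, HF).
    (* The derivability proof is an explicit pair, so that [simpl] reduces [derive_pt] to
       [f (G x)]. *)
    set (Prf := fun (a : R) (_ : G (x - 1) <= a <= G (x + 1)) =>
      exist (derivable_pt_abs F a) (f a) (DF a) : derivable_pt F a).
    assert (Hx : G (x - 1) <= G x <= G (x + 1)) by (split; apply Gmono; lra).
    destruct (Hg (G x)) as [Hpos _].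
    assert (H := derivable_pt_lim_recip_interv F G (x - 1) (x + 1) x Prf (CG x)
      ltac:(lra) ltac:(lra) Hx (fun z _ => HG z)).
    simpl in H. unfold f in H.
    apply is_derive_Reals.
    replace (g (G x)) with (1 / / g (G x)) by (field; lra).
    apply H, Rinv_neq_0_compat; lra.
Qed.

(** * Existence of the elliptic cosine for every real squared modulus *)

Lemma sin2_bounds (x : R) : 0 <= sin x ^ 2 <= 1.
Proof. pose proof (sin2_cos2 x). unfold Rsqr in H. nra. Qed.

Lemma jacobi_modulus_pos (k x : R) : k < 1 -> 0 < 1 - k * sin x ^ 2.
Proof.
  intro Hk. pose proof (sin2_bounds x).
  destruct (Rlt_le_dec (sin x ^ 2) 1) as [H1 | H1]; [nra |].
  replace (sin x ^ 2) with 1 by lra. lra.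
Qed.

Lemma amplitude_exists (k : R) : k < 1 ->
  exists phi : R -> R, phi 0 = 0 /\
    forall x, is_derive phi x (sqrt (1 - k * sin (phi x) ^ 2)).
Proof.
  intro Hk.
  (* [k] may be negative, and then the square root can exceed 1; this bound covers both signs. *)
  apply (autonomous_ode_global (fun x => sqrt (1 - k * sin x ^ 2)) (sqrt (1 + Rabs k))).
  - apply sqrt_lt_R0. pose proof (Rabs_pos k). lra.
  - intro x. pose proof (jacobi_modulus_pos k x Hk). pose proof (sin2_bounds x).
    split; [now apply sqrt_lt_R0 |].
    apply sqrt_le_1_alt. pose proof (Rle_abs (- k)) as Ha. rewrite Rabs_Ropp in Ha.
    pose proof (Rabs_pos k). nra.
  - intro x. apply (ex_derive_continuous (fun x => sqrt (1 - k * sin x ^ 2))).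
    auto_derive.
    pose proof (jacobi_modulus_pos k x Hk). simpl in *; lra.
Qed.

(** The chain rule puts the square root in the denominator, where it cancels against the derivative
    of [phi]. *)
Lemma is_derive_jacobi_dn (k : R) (phi : R -> R) : k < 1 ->
  (forall x, is_derive phi x (sqrt (1 - k * sin (phi x) ^ 2))) ->
  forall x, is_derive (fun y => sqrt (1 - k * sin (phi y) ^ 2)) x
    (- k * sin (phi x) * cos (phi x)).
Proof.
  intros Hk Hphi x.
  pose proof (jacobi_modulus_pos k (phi x) Hk) as Hp.
  pose proof (sqrt_lt_R0 _ Hp) as Hs.
  pose proof (is_derive_unique _ _ _ (Hphi x)) as HD.
  auto_derive.
  - split; [eexists; apply Hphi | split; [simpl in Hp; lra | trivial]].
  - change (Derive (fun x0 => phi x0)) with (Derive phi). rewrite HD.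
    replace (1 + - (k * (sin (phi x) * (sin (phi x) * 1))))
      with (1 - k * sin (phi x) ^ 2) by (simpl; ring).
    field. lra.
Qed.

Lemma is_jacobi_cn_intro (mu : R) (w w' : R -> R) :
  w 0 = 1 -> w' 0 = 0 -> (forall x, is_derive w x (w' x)) ->
  (forall x, is_derive w' x ((2 * mu - 1) * w x - 2 * mu * w x ^ 3)) ->
  is_jacobi_cn mu w.
Proof.
  intros H0 H0' Hw Hw'.
  assert (HD : forall x, Derive w x = w' x) by (intro; apply is_derive_unique, Hw).
  split; [assumption | split; [now rewrite HD |]].
  intro x. split; [eexists; apply Hw |].
  apply is_derive_ext with (f := w'); [intro; now rewrite HD | apply Hw'].
Qed.

Lemma is_jacobi_cn_exists_lt1 (mu : R) : mu < 1 -> exists w, is_jacobi_cn mu w.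
Proof.
  intro Hmu. destruct (amplitude_exists mu Hmu) as [phi [H0 Hphi]].
  set (dn := fun y => sqrt (1 - mu * sin (phi y) ^ 2)).
  assert (Hdn : forall x, is_derive dn x (- mu * sin (phi x) * cos (phi x)))
    by exact (is_derive_jacobi_dn mu phi Hmu Hphi).
  exists (fun x => cos (phi x)).
  apply is_jacobi_cn_intro with (fun x => - sin (phi x) * dn x).
  - rewrite H0; apply cos_0.
  - rewrite H0, sin_0; ring.
  - intro x. pose proof (is_derive_unique _ _ _ (Hphi x)) as HD.
    auto_derive; [eexists; apply Hphi |].
    change (Derive (fun x0 => phi x0)) with (Derive phi). rewrite HD; unfold dn; ring.
  - intro x. pose proof (is_derive_unique _ _ _ (Hphi x)) as HD.
    pose proof (is_derive_unique _ _ _ (Hdn x)) as HDd.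
    auto_derive.
    + split; [eexists; apply Hphi | split; [eexists; apply Hdn | trivial]].
    + change (Derive (fun x0 => dn x0)) with (Derive dn).
      change (Derive (fun x0 => phi x0)) with (Derive phi).
      rewrite HDd, HD. fold (dn x).
      assert (Hsq : dn x * dn x = 1 - mu * sin (phi x) ^ 2).
      { apply sqrt_sqrt. pose proof (jacobi_modulus_pos mu (phi x) Hmu). lra. }
      pose proof (sin2_cos2 (phi x)) as Hsc. unfold Rsqr in Hsc.
      (* Isolates the squares of [dn] and [sin]; both are polynomials in [cos (phi x)], which leaves
         the required cubic. *)
      transitivity (- cos (phi x) * (dn x * dn x) + mu * (sin (phi x) * sin (phi x)) * cos (phi x));
        [ring |].
      rewrite Hsq.
      replace (sin (phi x) ^ 2) with (1 - cos (phi x) * cos (phi x)) by (simpl; lra).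
      replace (sin (phi x) * sin (phi x)) with (1 - cos (phi x) * cos (phi x)) by lra.
      ring.
Qed.

Lemma is_jacobi_cn_exists_1 : exists w, is_jacobi_cn 1 w.
Proof.
  assert (Hp : forall x, 0 < exp x + exp (- x))
    by (intro x; pose proof (exp_pos x); pose proof (exp_pos (- x)); lra).
  exists (fun x => 2 / (exp x + exp (- x))).
  apply is_jacobi_cn_intro
    with (fun x => - 2 * (exp x - exp (- x)) / (exp x + exp (- x)) ^ 2).
  - rewrite Ropp_0, exp_0; field.
  - rewrite Ropp_0, exp_0; field.
  - intro x. pose proof (Hp x). auto_derive; [lra | field; lra].
  - intro x. pose proof (Hp x).
    assert (He : exp (- x) = / exp x) by apply exp_Ropp.
    pose proof (exp_pos x).
    auto_derive.
    + apply Rgt_not_eq. simpl. rewrite Rmult_1_r. now apply Rmult_lt_0_compat.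
    + rewrite He in *. field. split; [lra |].
      (* This product equals [exp x * exp x + 1], so the denominator left by [field] cannot
         vanish. *)
      intro E. assert (0 < exp x * (exp x + / exp x)) by now apply Rmult_lt_0_compat.
      rewrite Rmult_plus_distr_l, Rinv_r in H1 by lra. nra.
Qed.

(** Here [1 - mu * sin p ^ 2] is negative for some [p], so the amplitude is built for [/ mu < 1]
    instead and [dn] takes the place of [cos phi]. *)
Lemma is_jacobi_cn_exists_gt1 (mu : R) : 1 < mu -> exists w, is_jacobi_cn mu w.
Proof.
  intro Hmu.
  assert (Hk : / mu < 1) by (rewrite <- Rinv_1; apply Rinv_lt_contravar; lra).
  set (k := / mu) in *.
  destruct (amplitude_exists k Hk) as [phi [H0 Hphi]].
  set (dn := fun y => sqrt (1 - k * sin (phi y) ^ 2)).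
  assert (Hdn : forall x, is_derive dn x (- k * sin (phi x) * cos (phi x)))
    by exact (is_derive_jacobi_dn k phi Hk Hphi).
  set (r := sqrt mu).
  assert (Hr : r * r = mu) by (apply sqrt_sqrt; lra).
  assert (Hkm : k * mu = 1) by (unfold k; field; lra).
  assert (Hsq : forall z, dn z * dn z = 1 - k * sin (phi z) ^ 2).
  { intro z. apply sqrt_sqrt. pose proof (jacobi_modulus_pos k (phi z) Hk). lra. }
  exists (fun x => dn (r * x)).
  apply is_jacobi_cn_intro
    with (fun x => - r * k * sin (phi (r * x)) * cos (phi (r * x))).
  - unfold dn. rewrite Rmult_0_r, H0, sin_0.
    transitivity (sqrt 1); [f_equal; ring | apply sqrt_1].
  - rewrite Rmult_0_r, H0, sin_0; ring.
  - intro x. pose proof (is_derive_unique _ _ _ (Hdn (r * x))) as HDd.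
    auto_derive; [eexists; apply Hdn |].
    change (Derive (fun x0 => dn x0)) with (Derive dn). rewrite HDd; ring.
  - intro x. pose proof (is_derive_unique _ _ _ (Hphi (r * x))) as HD.
    auto_derive.
    + repeat split; eexists; apply Hphi.
    + change (Derive (fun x0 => phi x0)) with (Derive phi). rewrite HD.
      fold (dn (r * x)). specialize (Hsq (r * x)).
      set (d := dn (r * x)) in *. set (p := phi (r * x)) in *.
      pose proof (sin2_cos2 p) as Hsc. unfold Rsqr in Hsc.
      (* Inverting [Hsq] expresses both squares through [d], so that the second derivative becomes a
         cubic in [d]. *)
      assert (HS : sin p * sin p = mu * (1 - d * d))
        by (rewrite Hsq; transitivity (k * mu * (sin p * sin p)); [rewrite Hkm; ring | ring]).
      assert (HC : cos p * cos p = 1 - mu * (1 - d * d)) by lra.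
      transitivity (- (r * r) * k * d * (cos p * cos p - sin p * sin p)); [ring |].
      rewrite Hr, HC, HS.
      transitivity (- (k * mu) * d * (1 - mu * (1 - d * d) - mu * (1 - d * d))); [ring |].
      rewrite Hkm. ring.
Qed.

Lemma jacobi_cn_spec (mu : R) : is_jacobi_cn mu (jacobi_cn mu).
Proof.
  unfold jacobi_cn. apply epsilon_spec.
  destruct (Rtotal_order mu 1) as [H | [-> | H]].
  - now apply is_jacobi_cn_exists_lt1.
  - apply is_jacobi_cn_exists_1.
  - now apply is_jacobi_cn_exists_gt1.
Qed.

(** * First integral and the equation for the squared elliptic cosine *)

(** Conservation of energy: the difference [E] of the two sides has zero derivative by the equation
    for [w] and vanishes at 0 by the initial values. *)
Lemma jacobi_cn_first_integral (mu : R) (w : R -> R) : is_jacobi_cn mu w ->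
  forall x, Derive w x ^ 2 = (1 - w x ^ 2) * (1 - mu + mu * w x ^ 2).
Proof.
  intros [H0 [H0' H]] x.
  set (E := fun x => Derive w x ^ 2 - (1 - w x ^ 2) * (1 - mu + mu * w x ^ 2)).
  assert (HE : forall y, is_derive E y 0).
  { intro y. destruct (H y) as [Hw Hw']. unfold E.
    pose proof (is_derive_unique _ _ _ Hw') as HD.
    auto_derive.
    - split; [eexists; apply Hw' | repeat split; assumption].
    - change (Derive (fun x0 => w x0)) with (Derive w).
      change (Derive (fun x0 => Derive w x0)) with (Derive (Derive w)).
      rewrite HD. ring. }
  assert (Hc : E x = E 0).
  { destruct (MVT_gen E 0 x (fun _ => 0)) as [z [_ Hz]].
    - intros; apply HE.
    - intros; apply continuity_pt_filterlim, (ex_derive_continuous E).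
      eexists; apply HE.
    - lra. }
  unfold E in Hc. rewrite H0, H0' in Hc. lra.
Qed.

(** The second derivative of [w ^ 2] is [2 * w' ^ 2 + 2 * w * w'']; the first integral removes
    [w' ^ 2] and leaves a quadratic polynomial in [w ^ 2]. *)
Lemma is_derive2_scaled_square_cn (mu a b : R) (w : R -> R) : is_jacobi_cn mu w ->
  let U := fun x => a * w (b * x) ^ 2 in
  let U' := fun x => 2 * a * b * w (b * x) * Derive w (b * x) in
  forall x, is_derive U x (U' x) /\
    is_derive U' x (a * b ^ 2 *
      (2 * (1 - mu) + 4 * (2 * mu - 1) * w (b * x) ^ 2 - 6 * mu * w (b * x) ^ 4)).
Proof.
  intros Hw U U' x.
  pose proof (jacobi_cn_first_integral mu w Hw (b * x)) as HI.
  destruct Hw as [_ [_ Hw]]. destruct (Hw (b * x)) as [H1 H2].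
  pose proof (is_derive_unique _ _ _ H2) as HD.
  split; unfold U, U'.
  - auto_derive; [assumption |].
    change (Derive (fun x0 => w x0)) with (Derive w). ring.
  - auto_derive; [split; [assumption | split; [eexists; apply H2 | trivial]] |].
    change (Derive (fun x0 => w x0)) with (Derive w).
    change (Derive (fun x0 => Derive w x0)) with (Derive (Derive w)).
    rewrite HD.
    transitivity (2 * a * b ^ 2 * (Derive w (b * x) ^ 2
      + w (b * x) * ((2 * mu - 1) * w (b * x) - 2 * mu * w (b * x) ^ 3))); [ring |].
    rewrite HI. ring.
Qed.

(** * From the integrated wave equation to KdV *)

Section TravellingWave.

Variables (c kappa alpha A : R) (U U' : R -> R).
Hypothesis halpha : alpha <> 0.

(** The integrated equation solved for the second derivative. Being a formula in [U], it can be
    differentiated once more. *)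
Let U'' (x : R) : R := (A + c * U x - kappa / 2 * U x ^ 2) / alpha.

Hypothesis HU : forall x, is_derive U x (U' x).
Hypothesis HU' : forall x, is_derive U' x (U'' x).

Let U''' (x : R) : R := (c - kappa * U x) * U' x / alpha.

Lemma wave_is_derive3 (x : R) : is_derive U'' x (U''' x).
Proof.
  pose proof (is_derive_unique _ _ _ (HU x)) as HD. unfold U'', U'''.
  auto_derive; [repeat split; eexists; apply HU |].
  change (Derive (fun x0 => U x0)) with (Derive U).
  rewrite HD. field. assumption.
Qed.

Lemma wave_Derive1 (x : R) : Derive U x = U' x.
Proof. apply is_derive_unique, HU. Qed.

Lemma wave_Derive2 (x : R) : Derive_n U 2 x = U'' x.
Proof.
  simpl. rewrite (Derive_ext _ U'); [apply is_derive_unique, HU' | apply wave_Derive1].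
Qed.

Lemma wave_Derive3 (x : R) : Derive_n U 3 x = U''' x.
Proof.
  change (Derive (Derive_n U 2) x = U''' x).
  rewrite (Derive_ext _ U''); [apply is_derive_unique, wave_is_derive3 | apply wave_Derive2].
Qed.

Lemma wave_ex_derive_n (k : nat) (x : R) : (k <= 3)%nat -> ex_derive_n U k x.
Proof.
  intro Hk. destruct k as [|[|[|[|k]]]]; [exact I | | | | lia].
  - exists (U' x). apply HU.
  - exists (U'' x). apply is_derive_ext with (f := U'); [| apply HU'].
    intro; symmetry; apply wave_Derive1.
  - exists (U''' x). apply is_derive_ext with (f := U''); [| apply wave_is_derive3].
    intro; symmetry; apply wave_Derive2.
Qed.

Lemma wave_integrated_solution : integrated_wave_solution c kappa alpha A U.
Proof.
  intro x. split; [intros; apply wave_ex_derive_n; lia |].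
  rewrite wave_Derive2. unfold U''. field. assumption.
Qed.

(** Since [alpha * U''' = (c - kappa * U) * U'], the dispersive term cancels [- c * U'] from the
    time derivative and [kappa * U * U']. *)
Lemma wave_kdv_solution : kdv_solution kappa alpha (fun x t => U (x - c * t)).
Proof.
  intros x t.
  assert (Ht : is_derive (fun s => U (x - c * s)) t (- c * U' (x - c * t))).
  { pose proof (is_derive_unique _ _ _ (HU (x - c * t))) as HD.
    auto_derive; [eexists; apply HU |].
    change (Derive (fun x0 => U x0)) with (Derive U).
    change (x + - (c * t)) with (x - c * t). rewrite HD. ring. }
  assert (Hn : forall n, Derive_n (fun y => U (y - c * t)) n x = Derive_n U n (x - c * t))
    by (intro; apply (Derive_n_comp_trans U n x (- (c * t)))).
  split; [eexists; apply Ht | split].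
  - intros k Hk. apply (ex_derive_n_comp_trans U k x (- (c * t))).
    now apply wave_ex_derive_n.
  - assert (HDt : Derive (fun s => U (x - c * s)) t = - c * U' (x - c * t))
      by apply (is_derive_unique _ _ _ Ht).
    assert (HDx : Derive (fun y => U (y - c * t)) x = U' (x - c * t))
      by (etransitivity; [apply (Hn 1%nat) | apply wave_Derive1]).
    rewrite HDt, HDx, Hn, wave_Derive3. unfold U'''. field. assumption.
Qed.

End TravellingWave.

(** * Matching the parameters of the cnoidal profile *)

Lemma Rpower_quarter_sqr (D : R) : 0 < D -> Rpower D (1 / 4) ^ 2 = sqrt D.
Proof.
  intro HD. simpl. rewrite Rmult_1_r, <- Rpower_plus.
  replace (1 / 4 + 1 / 4) with (/ 2) by field. now apply Rpower_sqrt.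
Qed.

Theorem mainTheorem4 (alpha kappa A c s : R)
    (halpha : alpha <> 0) (hkappa : kappa <> 0) (hA : A <> 0)
    (hAkappa : A * kappa > - (3 * c ^ 2 / 8))
    (hs : s = 1 \/ s = -1) (hsalpha : s * alpha > 0) :
  kdv_solution kappa alpha
    (fun x t => cnoidal_profile s alpha kappa A c (x - c * t)) /\
  integrated_wave_solution c kappa alpha A (cnoidal_profile s alpha kappa A c).
Proof.
  (* This is [hAkappa] multiplied by 24. *)
  assert (HD : 0 < discr c kappa A) by (unfold discr; lra).
  unfold cnoidal_profile.
  set (D := discr c kappa A) in *.
  set (S := sqrt D).
  assert (HS : 0 < S) by now apply sqrt_lt_R0.
  assert (HSS : S * S = 9 * c ^ 2 + 24 * A * kappa) by (apply sqrt_sqrt; lra).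
  assert (Hss : s * s = 1) by (destruct hs as [-> | ->]; ring).
  set (mu := 1 / 2 + s * (3 * c / (2 * S))).
  set (a := (3 * c + s * S) / (2 * kappa)).
  set (b := 1 / 2 * (Rpower D (1 / 4) / sqrt (s * (3 * alpha)))).
  (* The frequency enters the wave equation only through this product; [1 / s = s] moves the sign
     into the numerator. *)
  assert (Hb : alpha * b ^ 2 = s * S / 12).
  { unfold b. assert (Hp : 0 < s * (3 * alpha)) by lra.
    transitivity (alpha / 4 * Rpower D (1 / 4) ^ 2 / sqrt (s * (3 * alpha)) ^ 2).
    - field. apply Rgt_not_eq, sqrt_lt_R0, Hp.
    - rewrite Rpower_quarter_sqr, pow2_sqrt by lra. fold S.
      replace (s * S / 12) with (s * S * (s * s) / (12 * (s * s))) by (rewrite Hss; field).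
      rewrite Hss. destruct hs as [-> | ->]; field; lra. }
  set (w := jacobi_cn mu).
  pose proof (is_derive2_scaled_square_cn mu a b w (jacobi_cn_spec mu)) as HU.
  cbv zeta in HU.
  set (U := fun x => a * w (b * x) ^ 2) in *.
  set (U' := fun x => 2 * a * b * w (b * x) * Derive w (b * x)) in *.
  assert (HU' : forall x, is_derive U' x ((A + c * U x - kappa / 2 * U x ^ 2) / alpha)).
  { intro x. destruct (HU x) as [_ H].
    match type of H with is_derive _ _ ?l => replace (_ / alpha) with l; [exact H |] end.
    unfold U. set (y := w (b * x)).
    apply Rmult_eq_reg_l with alpha; [| assumption].
    (* Coefficients in [y]: degree 4 needs [mu * s * S = kappa * a], degree 2 needs
       [(2 * mu - 1) * s * S = 3 * c], and degree 0 needs [a * (1 - mu) * s * S = 6 * A]. The last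
       one uses [HSS], hence the rewriting of [A] through [S]. *)
    transitivity (a * (alpha * b ^ 2)
      * (2 * (1 - mu) + 4 * (2 * mu - 1) * y ^ 2 - 6 * mu * y ^ 4)); [ring |].
    rewrite Hb.
    replace A with ((S * S - 9 * c ^ 2) / (24 * kappa)) by (rewrite HSS; field; assumption).
    unfold a, mu. destruct hs as [-> | ->]; field; repeat split; lra. }
  split.
  - apply (wave_kdv_solution c kappa alpha A U U' halpha (fun x => proj1 (HU x)) HU').
  - apply (wave_integrated_solution c kappa alpha A U U' halpha (fun x => proj1 (HU x)) HU').
Qed.
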